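(* Let $A\in\mathbb{C}^{n\times n}$ be Hermitian with eigenvalues $\lambda_1\ge\cdots\ge\lambda_n$ and associated orthonormal eigenvectors $x_1,\ldots,x_n$. Let $\mathcal{Y}\subseteq\mathbb{C}^n$ be a subspace with $p=\dim\mathcal{Y}$, $1\le p<n$, let $f$ be a scalar function defined on the eigenvalues of $A$, and let $\mathcal{Y}'=f(A)\mathcal{Y}$. For $i\in\{1,\ldots,p\}$ define $\mathcal{X}_{[1,i]\cup(p,n]}=\mathrm{span}\{x_{i+1},\ldots,x_p\}^{\perp}$ (so $\mathcal{X}_{[1,i]\cup(p,n]}=\mathbb{C}^n$ for $i=p$), $\mathcal{Y}_{[1,i]\cup(p,n]}=\mathcal{X}_{[1,i]\cup(p,n]}\cap\mathcal{Y}$, and $\mathcal{Y}'_{[1,i]\cup(p,n]}=f(A)\mathcal{Y}_{[1,i]\cup(p,n]}$. Assume that the smallest ($p$th largest) Ritz value $\eta_p$ of $A$ in $\mathcal{Y}$ satisfies $\eta_p>\lambda_{p+1}$, and that $|f(\lambda_1)|\ge\cdots\ge|f(\lambda_p)|>\max_{j\in\{p+1,\ldots,n\}}|f(\lambda_j)|$. Then $\dim\mathcal{Y}'=p$ and $\dim\mathcal{Y}_{[1,i]\cup(p,n]}=\dim\mathcal{Y}'_{[1,i]\cup(p,n]}=i$. Moreover, the smallest ($i$th largest) Ritz values $\widetilde{\eta}_i$ in $\mathcal{Y}_{[1,i]\cup(p,n]}$ and $\widetilde{\eta}'_i$ in $\mathcal{Y}'_{[1,i]\cup(p,n]}$ satisfy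 $$\frac{\lambda_i-\widetilde{\eta}'_i}{\widetilde{\eta}'_i-\lambda_{p+1}}\le\frac{\max_{j\in\{p+1,\ldots,n\}}|f(\lambda_j)|^2}{|f(\lambda_i)|^2}\ \frac{\lambda_i-\widetilde{\eta}_i}{\widetilde{\eta}_i-\lambda_{p+1}}.$$ Consequently, the $i$th largest Ritz value $\eta'_i$ in $\mathcal{Y}'$ satisfies $$\frac{\lambda_i-\eta'_i}{\eta'_i-\lambda_{p+1}}\le\frac{\max_{j\in\{p+1,\ldots,n\}}|f(\lambda_j)|^2}{|f(\lambda_i)|^2}\ \frac{\lambda_i-\eta_p}{\eta_p-\lambda_{p+1}}.$$
   Context: Eigenvalues are counted with multiplicity and $Ax_j=\lambda_jx_j$. The matrix function is $f(A)=\sum_{j=1}^n f(\lambda_j)x_jx_j^H$, and $f(A)\mathcal{U}=\{f(A)u:u\in\mathcal{U}\}$ for a subspace $\mathcal{U}$. Orthogonality and $\perp$ refer to the Euclidean inner product. For a subspace $\mathcal{U}\subseteq\mathbb{C}^n$ of dimension $d\ge1$ with orthonormal basis matrix $U\in\mathbb{C}^{n\times d}$, the Ritz values of $A$ in $\mathcal{U}$ are the $d$ eigenvalues (with multiplicity) of $U^HAU$; they do not depend on the choice of $U$. They are ordered decreasingly, so the $i$th largest Ritz value is the $i$th in this order. *)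

(* Defs.v *)
From HB Require Import structures.
From mathcomp Require Import all_boot all_order all_algebra.
From mathcomp Require Import sesquilinear spectral complex.

Set Implicit Arguments.
Unset Strict Implicit.
Unset Printing Implicit Defensive.

Import Order.TTheory GRing.Theory Num.Theory Num.Def.
Local Open Scope ring_scope.
Local Open Scope sesquilinear_scope.

Section LinearAlgebra.
Variable C : numClosedFieldType.

(* The Euclidean inner product on column vectors; as for the library's dotmx
   on row vectors, it is antilinear in the second argument (see dotcvE). *)
Definition dotcv n (u v : 'cV[C]_n) : C := form_of_matrix conjC 1%:M u v.

HB.instance Definition _ n :=
  Bilinear.copy (@dotcv n) (form_of_matrix conjC 1%:M).
HB.instance Definition _ n :=
  Hermitian.copy (@dotcv n) (form_of_matrix conjC 1%:M).

Lemma dotcvE n (u v : 'cV[C]_n) : dotcv u v = (v^t* *m u) 0 0.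
Proof.
by rewrite /dotcv /form_of_matrix mulmx1 mxtrace_mulC trace_mx11.
Qed.

Fact dotcv_gt0 n (u : 'cV[C]_n) : u != 0 -> 0 < dotcv u u.
Proof.
move=> uN0; rewrite dotcvE !mxE lt_def; apply/andP; split; last first.
  by apply: sumr_ge0 => i _; rewrite !mxE mulrC mul_conjC_ge0.
apply: contra uN0 => /eqP uu0; apply/eqP/colP => i; rewrite mxE; apply/eqP.
have /psumr_eq0P: forall k, true -> 0 <= (u^t* 0 k * u k 0).
  by move=> k _; rewrite !mxE mulrC mul_conjC_ge0.
by move=> /(_ uu0 i isT); rewrite !mxE mulrC => /eqP; rewrite mul_conjC_eq0.
Qed.

HB.instance Definition _ n := isDotProduct.Build C _ (@dotcv n) (@dotcv_gt0 n).

Definition mximg m n (B : 'M[C]_(m, n)) (U : {vspace 'cV[C]_n}) :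
  {vspace 'cV[C]_m} := (linfun (mulmx B) @: U)%VS.

Definition is_onbmx n d (U : {vspace 'cV[C]_n}) (V : 'M[C]_(n, d)) : Prop :=
  V^t* *m V = 1%:M /\ mximg V fullv = U.

(* An orthonormal basis matrix obtained by Gram-Schmidt: schmidt works on the
   rows of a matrix, hence the transpositions. *)
Definition onbmx n (U : {vspace 'cV[C]_n}) : 'M[C]_(n, \dim U) :=
  (schmidt (\matrix_(k < \dim U) ((vbasis U)`_k)^T))^T.

(* The eigenvalues with multiplicity, as the roots of the characteristic
   polynomial. *)
Definition eigenvalues d (M : 'M[C]_d) : seq C :=
  sval (closed_field_poly_normal (char_poly M)).

Lemma eigenvaluesP d (M : 'M[C]_d) :
  char_poly M = \prod_(z <- eigenvalues M) ('X - z%:P).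
Proof.
rewrite /eigenvalues; case: closed_field_poly_normal => r /= {1}->.
by rewrite (monicP (char_poly_monic M)) scale1r.
Qed.

Lemma size_eigenvalues d (M : 'M[C]_d) : size (eigenvalues M) = d.
Proof.
by have := size_char_poly M; rewrite eigenvaluesP size_prod_XsubC => -[].
Qed.

Lemma mximgP m n (B : 'M[C]_(m, n)) (U : {vspace 'cV[C]_n}) v :
  reflect (exists2 u, u \in U & v = B *m u) (v \in mximg B U).
Proof.
apply: (iffP memv_imgP) => -[u uU ->]; exists u => //; by rewrite lfunE.
Qed.

Lemma dim_cV n : \dim {: 'cV[C]_n} = n.
Proof. by rewrite dimvf /dim /= muln1. Qed.

Lemma onbmxP n (U : {vspace 'cV[C]_n}) : is_onbmx U (onbmx U).
Proof.
set M := \matrix_(k < \dim U) ((vbasis U)`_k)^T.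
have dU : (\dim U <= n)%N by rewrite -[X in (_ <= X)%N](dim_cV n) dimvS ?subvf.
have Mfree : row_free M.
  apply/row_freeP.
  suff: kermx M == 0.
    rewrite kermx_eq0 => /row_freeP; exact.
  apply/eqP/row_matrixP => i; rewrite row0; set w := row i _.
  have wM : w *m M = 0 by apply/sub_kermxP; exact: row_sub.
  have /freeP fb := basis_free (vbasisP U).
  apply/rowP => k; rewrite [RHS]mxE.
  suff s0 : \sum_(j < \dim U) w 0 j *: (vbasis U)`_j = 0 by exact: (fb _ s0).
  apply/trmx_inj; rewrite trmx0 -wM mulmx_sum_row linear_sum /=.
  by apply: eq_bigr => j _; rewrite linearZ /= rowK.
split.
  rewrite /onbmx -/M; move: (schmidt_unitarymx M dU) => /unitarymxP.
  move=> /(congr1 (map_mx conjC)); rewrite map_mxM map_mxCK map_mx1 => <-.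
  by rewrite trmxK.
apply/vspaceP => v; apply/mximgP/idP => [[w _ ->]|vU].
  have: ((onbmx U *m w)^T <= M)%MS.
    by rewrite -(eqmx_schmidt_free Mfree) /onbmx trmx_mul trmxK submxMl.
  case/submxP => a /(congr1 trmx); rewrite trmxK => ->.
  rewrite mulmx_sum_row linear_sum; apply: memv_suml => k _ /=.
  by rewrite linearZ /= rowK trmxK memvZ // vbasis_mem // mem_nth ?size_tuple.
have: (v^T <= M)%MS.
  rewrite (coord_vbasis vU) linear_sum; apply: summx_sub => k _ /=.
  by rewrite linearZ /= scalemx_sub // -[X in (X <= _)%MS](rowK (fun k => ((vbasis U)`_k)^T)) row_sub.
rewrite -(eqmx_schmidt_free Mfree) => /submxP[a /(congr1 trmx)].
by rewrite trmxK trmx_mul => ->; exists a^T => //; rewrite memvf.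
Qed.

End LinearAlgebra.

Section Ritz.
Variable R : rcfType.
Implicit Types n d : nat.

Definition matfun n (f : R -> R[i]) (lam : 'I_n -> R) (x : 'I_n -> 'cV[R[i]]_n) :
  'M[R[i]]_n := \sum_j f (lam j) *: (x j *m (x j)^t*).

(* Meant for Hermitian matrices, whose eigenvalues are real. *)
Definition deigenvalues d (M : 'M[R[i]]_d) : seq R :=
  sort >=%R [seq complex.Re z | z <- eigenvalues M].

(* The Ritz values of A in U in decreasing order: the (k+1)th largest one is
   (ritz A U)`_k. *)
Definition ritz n (A : 'M[R[i]]_n) (U : {vspace 'cV[R[i]]_n}) : seq R :=
  deigenvalues ((onbmx U)^t* *m A *m onbmx U).

Lemma size_ritz n (A : 'M[R[i]]_n) U : size (ritz A U) = \dim U.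
Proof. by rewrite /ritz /deigenvalues size_sort size_map size_eigenvalues. Qed.

Lemma deigenvalues_sorted d (M : 'M[R[i]]_d) : sorted >=%R (deigenvalues M).
Proof. by apply: sort_sorted => a b; exact: le_total. Qed.

Lemma hermitian_eigenvalue_real d (M : 'M[R[i]]_d) z :
  M \is hermsymmx -> z \in eigenvalues M -> z \is Num.real.
Proof.
move=> /is_hermitianmxP; rewrite expr0 scale1r => Mh.
rewrite -root_prod_XsubC -eigenvaluesP -eigenvalue_root_char.
case/eigenvalueP => v vM vN0.
have vv : 0 < dotmx v v by rewrite dnorm_gt0.
have E : dotmx (v *m M) v = dotmx v (v *m M).
  by rewrite !dotmxE trmx_mul map_mxM -Mh mulmxA.
move: E; rewrite vM linearZl_LR linearZr_LR /=.
by move=> /(mulIf (lt0r_neq0 vv)) zz; apply/CrealP; rewrite -zz.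
Qed.

Lemma deigenvaluesP d (M : 'M[R[i]]_d) : M \is hermsymmx ->
  char_poly M = \prod_(t <- deigenvalues M) ('X - (t%:C)%C%:P).
Proof.
move=> Mh; rewrite [LHS]eigenvaluesP /deigenvalues.
rewrite (perm_big _ (permEl (perm_sort _ _))) big_map /=.
apply: eq_big_seq => z zM; congr ('X - _%:P).
by rewrite RRe_real // (hermitian_eigenvalue_real Mh).
Qed.

Lemma char_poly_conj d (P Q M : 'M[R[i]]_d) : P *m Q = 1%:M ->
  char_poly (P *m M *m Q) = char_poly M.
Proof.
move=> PQ; rewrite /char_poly /char_poly_mx !map_mxM /=.
set P' := map_mx polyC P; set Q' := map_mx polyC Q.
have PQ' : P' *m Q' = 1%:M by rewrite -map_mxM PQ map_mx1.
have -> : 'X%:M - P' *m map_mx polyC M *m Q' =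
          P' *m ('X%:M - map_mx polyC M) *m Q'.
  by rewrite mulmxBr mulmxBl mul_mx_scalar -scalemxAl PQ' scalemx1.
by rewrite !det_mulmx mulrAC -det_mulmx PQ' det1 mul1r.
Qed.

Lemma ritz_onb n (A : 'M[R[i]]_n) U (V : 'M[R[i]]_(n, \dim U)) :
  is_onbmx U V -> ritz A U = deigenvalues (V^t* *m A *m V).
Proof.
move=> [V1 VU]; have [] := onbmxP U; rewrite /ritz; set W := onbmx U => W1 WU.
have [Q QE] : exists Q, Q = W^t* *m V by eexists.
have VW v : v \in mximg V fullv -> v \in mximg W fullv by rewrite VU WU.
have VE : V = W *m Q.
  suff H k : col k V = col k (W *m Q).
    apply/matrixP => i k; have /colP/(_ i) := H k.
    by rewrite [LHS]mxE [RHS]mxE.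
  have /VW/mximgP[w _ Vk] : col k V \in mximg V fullv.
    by apply/mximgP; exists (delta_mx k 0); rewrite ?memvf // colE.
  rewrite [RHS]colE -[RHS]mulmxA QE -[in RHS]mulmxA -[V *m _]colE Vk.
  by rewrite [W^t* *m _]mulmxA W1 mul1mx.
have QQ : Q^t* *m Q = 1%:M.
  rewrite -V1 [in RHS]VE trmx_mul map_mxM -[in RHS]mulmxA.
  by rewrite [W^t* *m (W *m Q)]mulmxA W1 mul1mx.
have -> : V^t* *m A *m V = Q^t* *m (W^t* *m A *m W) *m Q.
  by rewrite VE trmx_mul map_mxM !mulmxA.
by rewrite /deigenvalues /eigenvalues (char_poly_conj _ QQ).
Qed.

End Ritz.

(* Main.v *)
Require Import Defs.
From HB Require Import structures.
From mathcomp Require Import all_boot all_order all_algebra.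
From mathcomp Require Import sesquilinear spectral complex.
From mathcomp Require Import perm lra ring.
From mathcomp Require Import reals.

(** Everything is read off the sign of the Hermitian form of A - t.  Its value
    at u is [excess A t u], for u nonzero nonnegative exactly when the Rayleigh
    quotient of u is at least t.  An orthonormal basis of a subspace U in which the compressed
    matrix is diagonal ([ritz_diagonalization]) shows that the last Ritz value
    in U is the least Rayleigh quotient and is attained
    ([excess_ritz_ge0], [excess_ritz_eq0]), and, by counting dimensions, that a
    lower bound t for the Rayleigh quotients on a (k+1)-dimensional subspace of
    U bounds the (k+1)th Ritz value in U from below ([ritz_ge]).

    Write mu for lam p and L for lam i.  In the eigenbasis x,
    excess A t u = sum_j (lam_j - t) |<u, x_j>|^2, and applying f(A) multiplies
    the jth weight by |f(lam_j)|^2.  A vector of Y orthogonal to the first p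
    eigenvectors has Rayleigh quotient at most mu < eta_p, hence vanishes.  This
    makes f(A) injective on Y and, with a count of orthogonality conditions,
    gives all the dimensions.

    On Y_i only the eigenvectors with j <= i or j >= p occur.  For t = L, and
    likewise for t = mu, the factor lam_j - t is nonnegative for j <= i and
    nonpositive for j >= p, whereas |f(lam_j)| is at least |f(L)| on the first
    group and at most fmax < |f(L)| on the second.  A comparison term by term
    ([excess_matfun_ge]) therefore gives, for y' = f(A) y,
      fmax^2 excess A L y <= excess A L y',
      |f(L)|^2 excess A mu y <= excess A mu y'.
    Let y' attain the Ritz value eta'.  The two inequalities bound
    (L - eta') |y'|^2 from above and (eta' - mu) |y'|^2 from below in terms of
    y, whose Rayleigh quotient is at least eta; their quotient is the claim for
    Y_i and Y'_i ([ritz_filter_ratio]).  The last inequality follows because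
    t |-> (L - t) / (t - mu) is nonincreasing ([ratio_antitone]), the
    (i+1)th Ritz value in Y' is at least eta' by [ritz_ge], and eta is at least
    eta_p.  Indices start at 0 throughout. *)

Set Implicit Arguments.
Unset Strict Implicit.
Unset Printing Implicit Defensive.

Import Order.TTheory GRing.Theory Num.Theory Num.Def.
Import ComplexField.Normc.
Local Open Scope ring_scope.
Local Open Scope sesquilinear_scope.

(** * Orthonormal bases that diagonalize a compression *)

Section DiagonalOrthonormalBasis.
Variable R : rcfType.
Local Notation C := R[i].

(** The spectral theorem lists the eigenvalues in an unspecified order.  The
    characteristic polynomial identifies this list with [deigenvalues M] up to
    a permutation, and permuting the columns sorts it. *)
Lemma hermitian_diagonalization d (M : 'M[C]_d) : M \is hermsymmx ->
  exists2 Q : 'M[C]_d, Q^t* *m Q = 1%:M &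
    Q^t* *m M *m Q = diag_mx (\row_k ((deigenvalues M)`_k)%:C%C).
Proof.
move=> Mh; set P := spectralmx M; set sp := spectral_diag M.
have Pu : P \is unitarymx by exact: spectral_unitarymx.
have PP : P *m P^t* = 1%:M by apply/unitarymxP.
have PP' : P^t* *m P = 1%:M by apply: mulmx1C.
have ME : M = P^t* *m diag_mx sp *m P.
  by rewrite -invmx_unitary //; apply/orthomx_spectralP/hermitian_normalmx.
have sz : size (deigenvalues M) = d.
  by rewrite /deigenvalues size_sort size_map size_eigenvalues.
have char_sp : char_poly M = \prod_(z <- [tuple sp 0 k | k < d]) ('X - z%:P).
  rewrite [in LHS]ME char_poly_conj // char_poly_trig ?diag_mx_is_trig //.
  by rewrite big_map big_enum /=; apply: eq_bigr => k _; rewrite mxE eqxx.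
have : perm_eq [tuple ((deigenvalues M)`_k)%:C%C | k < d]
               [tuple sp 0 k | k < d].
  apply: prod_XsubC_eq; rewrite -char_sp deigenvaluesP // big_map big_enum /=.
  by rewrite (big_nth 0) sz big_mkord.
case/tuple_permP => s /val_inj sE.
have spE (k : 'I_d) : ((deigenvalues M)`_k)%:C%C = sp 0 (s k).
  by have /(congr1 (fun t => tnth t k)) := sE; rewrite !tnth_mktuple.
have tQ : (colsub s (P^t*))^t* = rowsub s P.
  by apply/matrixP => i j; rewrite !mxE conjCK.
exists (colsub s (P^t*)); rewrite tQ.
  rewrite mulmx_colsub mul_rowsub_mx PP; apply/matrixP => i j.
  by rewrite !mxE (inj_eq perm_inj).
rewrite {1}ME mulmx_colsub !mul_rowsub_mx !mulmxA PP mul1mx -mulmxA PP mulmx1.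
by apply/matrixP => i j; rewrite !mxE (inj_eq perm_inj) spE.
Qed.

Lemma is_onbmx_mulr n d (U : {vspace 'cV[C]_n}) (V : 'M[C]_(n, d))
    (Q : 'M[C]_d) :
  is_onbmx U V -> Q^t* *m Q = 1%:M -> is_onbmx U (V *m Q).
Proof.
move=> [V1 VU] Q1; split.
  by rewrite trmx_mul map_mxM -mulmxA [V^t* *m _]mulmxA V1 mul1mx.
rewrite -VU; apply/vspaceP => v; apply/mximgP/mximgP => -[w _ ->].
  by exists (Q *m w); rewrite ?memvf // mulmxA.
exists (Q^t* *m w); rewrite ?memvf //.
by rewrite -mulmxA [Q *m _]mulmxA (mulmx1C Q1) mul1mx.
Qed.

(** In coordinates with respect to V, the form of A on U becomes a weighted sum
    of squares whose weights are the Ritz values in decreasing order. *)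
Lemma ritz_diagonalization n (A : 'M[C]_n) (U : {vspace 'cV[C]_n}) :
  A \is hermsymmx -> exists2 V : 'M[C]_(n, \dim U), is_onbmx U V &
    V^t* *m A *m V = diag_mx (\row_k ((ritz A U)`_k)%:C%C).
Proof.
move=> /is_hermitianmxP; rewrite expr0 scale1r => Ah.
set W := onbmx U; have Mh : W^t* *m A *m W \is hermsymmx.
  apply/is_hermitianmxP; rewrite expr0 scale1r !trmx_mul !map_mxM -Ah.
  by rewrite map_trmx trmxK -map_mx_comp (map_mx_id (@conjCK _)) mulmxA.
have [Q Q1 QD] := hermitian_diagonalization Mh.
exists (W *m Q); first exact: is_onbmx_mulr (onbmxP U) Q1.
by rewrite trmx_mul map_mxM -QD !mulmxA.
Qed.

End DiagonalOrthonormalBasis.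

(** * Vectors orthogonal to part of a family *)

Section OrthogonalSubfamily.
Variable C : numClosedFieldType.

(** A half-open range of indices covers both the eigenvectors between i and p
    and an initial segment of a family, with b - a conditions at most. *)
Definition orthocompl n d (x : 'I_d -> 'cV[C]_n) a b : {vspace 'cV[C]_n} :=
  orthov (@dotcv C n) <<[seq x j | j : 'I_d <- enum 'I_d & (a <= j < b)%N]>>%VS.

Lemma orthocomplP n d (x : 'I_d -> 'cV[C]_n) a b u :
  reflect (forall j : 'I_d, (a <= j < b)%N -> dotcv u (x j) = 0)
          (u \in orthocompl x a b).
Proof.
apply: (iffP idP) => [/mem_orthovP u0 j jab|u0].
  by apply: u0; rewrite memv_span // map_f // mem_filter jab mem_enum.
rewrite mem_orthov_sym; apply/span_subvP => _ /mapP[j + ->].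
rewrite mem_filter => /andP[/u0 xj0 _].
by rewrite mem_orthov1 herm_eq0C; exact/eqP.
Qed.

(** The orthogonality conditions cut out the kernel of a matrix with at most
    b - a rows, so rank-nullity bounds the loss of dimension. *)
Lemma dim_orthocompl n d (x : 'I_d -> 'cV[C]_n) a b (U : {vspace 'cV[C]_n}) :
  (\dim U <= \dim (orthocompl x a b :&: U) + (b - a))%N.
Proof.
pose s := [seq x j | j : 'I_d <- enum 'I_d & (a <= j < b)%N].
have s_size : (size s <= b - a)%N.
  have -> : size s = size [seq j <- iota 0 d | (a <= j < b)%N].
    by rewrite -val_enum_ord filter_map !size_map.
  rewrite -[(b - a)%N](size_iota a).
  apply: uniq_leq_size => [|j]; first by rewrite filter_uniq ?iota_uniq.
  rewrite mem_filter !mem_iota => /andP[/andP[aj jb] _].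
  by rewrite aj /= subnKC // (leq_trans aj) // ltnW.
pose B := \matrix_(k < size s) (s`_k)^t*.
pose h := linfun (mulmx B : 'cV_n -> 'cV_(size s)).
rewrite -(limg_ker_dim h U) leq_add //; last first.
  by rewrite (leq_trans (dimvS (subvf _))) // dimvf /dim /= muln1.
apply/dimvS/subvP => u; rewrite !memv_cap memv_ker lfunE => /andP[-> /eqP Bu].
rewrite andbT; apply/orthocomplP => j jab.
have js : x j \in s by rewrite map_f // mem_filter jab mem_enum.
have xs : (index (x j) s < size s)%N by rewrite index_mem.
have /colP/(_ (Ordinal xs)) := Bu; rewrite [RHS]mxE => <-.
rewrite dotcvE -{1}(nth_index 0 js) !mxE; apply: eq_bigr => k _.
by rewrite !mxE.
Qed.

Lemma exists_orthogonal n d (x : 'I_d -> 'cV[C]_n) a b (U : {vspace 'cV[C]_n}) :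
    (b - a < \dim U)%N ->
  exists u, [/\ u \in U, u != 0 &
    forall j : 'I_d, (a <= j < b)%N -> dotcv u (x j) = 0].
Proof.
move=> abU; pose U' := (orthocompl x a b :&: U)%VS; exists (vpick U').
have : vpick U' \in U' by exact: memv_pick.
rewrite memv_cap => /andP[/orthocomplP u0 uU]; split=> //.
rewrite vpick0 -dimv_eq0 -lt0n -(ltn_add2r (b - a)) add0n.
exact: leq_trans abU (dim_orthocompl _ _ _ _).
Qed.

Lemma coord_dotcv n d (V : 'M[C]_(n, d)) u j :
  (V^t* *m u) j 0 = dotcv u (col j V).
Proof. by rewrite dotcvE !mxE; apply: eq_bigr => k _; rewrite !mxE. Qed.

End OrthogonalSubfamily.

(** * Extremal properties of Ritz values *)

Section MinMax.
Variable R : rcfType.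
Local Notation C := R[i].

Lemma normc_ge0 (z : C) : 0 <= normc z.
Proof. by case: z => a b; exact: sqrtr_ge0. Qed.

Lemma mulC_conj_normc (z : C) : z * conjC z = (normc z ^+ 2)%:C%C.
Proof. by rewrite -normCK rmorphXn /=. Qed.

(** For Hermitian A the inner product is real, so its real part loses
    nothing; the value is |u|^2 times the amount by which the Rayleigh quotient
    of u exceeds t. *)
Definition excess n (A : 'M[C]_n) (t : R) (u : 'cV[C]_n) : R :=
  complex.Re (dotcv (A *m u - t%:C%C *: u) u).

Definition sqnorm n (u : 'cV[C]_n) : R := complex.Re (dotcv u u).

Lemma sqnorm_gt0 n (u : 'cV[C]_n) : u != 0 -> 0 < sqnorm u.
Proof.
by move/dotcv_gt0; rewrite /sqnorm; case: (dotcv u u) => a b; simpc => /andP[].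
Qed.

Lemma excess_shift n (A : 'M[C]_n) (s t : R) u :
  excess A t u = excess A s u + (s - t) * sqnorm u.
Proof.
rewrite /excess /sqnorm.
have -> : A *m u - t%:C%C *: u = (A *m u - s%:C%C *: u) + (s - t)%:C%C *: u.
  by rewrite rmorphB scalerBl addrA subrK.
rewrite linearDl linearZl /=.
by case: (dotcv _ u) => a b; case: (dotcv _ u) => a' b'; simpc.
Qed.

Lemma excess_diag n d (A : 'M[C]_n) (V : 'M[C]_(n, d)) (r : 'I_d -> R) t w :
    V^t* *m V = 1%:M -> V^t* *m A *m V = diag_mx (\row_k (r k)%:C%C) ->
  excess A t (V *m w) = \sum_k (r k - t) * normc (w k 0) ^+ 2.
Proof.
move=> V1 VD; rewrite /excess dotcvE.
have -> : (V *m w)^t* *m (A *m (V *m w) - t%:C%C *: (V *m w)) =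
    w^t* *m (diag_mx (\row_k (r k)%:C%C) *m w - t%:C%C *: w).
  rewrite trmx_mul map_mxM !mulmxBr -VD -!mulmxA; congr (_ - _).
  by rewrite -!scalemxAr [V^t* *m _]mulmxA V1 mul1mx.
rewrite mul_diag_mx mxE raddf_sum /=; apply: eq_bigr => k _.
by rewrite !mxE -mulrBl -rmorphB mulrCA [_ * w k 0]mulrC mulC_conj_normc
  -rmorphM.
Qed.

Lemma onbmx_coord n d (U : {vspace 'cV[C]_n}) (V : 'M[C]_(n, d)) u :
  is_onbmx U V -> u \in U -> u = V *m (V^t* *m u).
Proof.
move=> [V1 <-] /mximgP[w _ ->].
by rewrite [V^t* *m _]mulmxA V1 mul1mx.
Qed.

Section RitzBounds.
Variables (n : nat) (A : 'M[C]_n).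
Hypothesis Ah : A \is hermsymmx.

Lemma ritz_nonincreasing (U : {vspace 'cV[C]_n}) j k :
  (j <= k < \dim U)%N -> (ritz A U)`_k <= (ritz A U)`_j.
Proof.
move=> /andP[jk kd].
have ge_trans : transitive (>=%R : rel R).
  by move=> a b c ba ac; exact: le_trans ac ba.
apply: (sorted_leq_nth ge_trans (@lexx _ R) _ (deigenvalues_sorted _)) => //.
  by rewrite inE size_ritz (leq_ltn_trans jk).
by rewrite inE size_ritz.
Qed.

(** In the Ritz basis the form is a sum of squares with nonnegative weights, as
    the last Ritz value is the least one.  When U is zero so is u, and the
    default value of [nth] does not affect the claim. *)
Lemma excess_ritz_ge0 (U : {vspace 'cV[C]_n}) u :
  u \in U -> 0 <= excess A (ritz A U)`_(\dim U).-1 u.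
Proof.
move=> uU; have [V Vonb VD] := ritz_diagonalization U Ah.
rewrite (onbmx_coord Vonb uU) (excess_diag _ _ Vonb.1 VD).
apply: sumr_ge0 => k _; rewrite mulr_ge0 ?sqr_ge0 // subr_ge0.
apply: ritz_nonincreasing; case: (\dim U) k => [[]//|d k].
by rewrite -ltnS ltn_ord ltnSn.
Qed.

Lemma excess_ritz_eq0 (U : {vspace 'cV[C]_n}) : (0 < \dim U)%N ->
  exists u, [/\ u \in U, u != 0 & excess A (ritz A U)`_(\dim U).-1 u = 0].
Proof.
move=> d0; have [V [V1 VU] VD] := ritz_diagonalization U Ah.
have dP : ((\dim U).-1 < \dim U)%N by rewrite prednK.
pose e : 'cV[C]_(\dim U) := delta_mx (Ordinal dP) 0.
exists (V *m e); split.
- suff: V *m e \in mximg V fullv by rewrite VU.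
  by apply/mximgP; exists e; rewrite ?memvf.
- apply/eqP => /(congr1 (mulmx (V^t*))); rewrite mulmxA V1 mul1mx mulmx0.
  by move/colP/(_ (Ordinal dP))/eqP; rewrite !mxE !eqxx oner_eq0.
- rewrite (excess_diag _ _ V1 VD) big1 // => k _; rewrite mxE eqxx andbT.
  case: eqP => [->|_]; first by rewrite subrr mul0r.
  by rewrite normc0 expr0n mulr0.
Qed.

(** Lower half of the Courant-Fischer principle.  Since k < dim W, some nonzero
    w in W has no component along the first k Ritz vectors of U; were the Ritz
    value with index k below t, all Ritz values that contribute to the form at
    w would be, and the form of A - t would be negative at w. *)
Lemma ritz_ge (U W : {vspace 'cV[C]_n}) k t :
    (W <= U)%VS -> (k < \dim W)%N -> {in W, forall w, 0 <= excess A t w} ->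
  t <= (ritz A U)`_k.
Proof.
move=> WU kW Wt; have [V Vonb VD] := ritz_diagonalization U Ah.
have [|w [wW wN0 w0]] := @exists_orthogonal _ _ _ (fun j => col j V) 0 k W.
  by rewrite subn0.
have wU := subvP WU _ wW; have wE := onbmx_coord Vonb wU.
set c := V^t* *m w in wE; have c0 (j : 'I_(\dim U)) : (j < k)%N -> c j 0 = 0.
  by move=> jk; rewrite coord_dotcv w0.
rewrite leNgt; apply/negP => rt; have := Wt w wW; apply/negP; rewrite -ltNge.
have [j cj] : exists j, c j 0 != 0.
  apply/existsP; apply: contra_neqT wN0; rewrite negb_exists => /forallP c_eq0.
  rewrite wE -[RHS](mulmx0 _ V); congr mulmx; apply/colP => j; rewrite [RHS]mxE.
  exact/eqP/negPn/c_eq0.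
have lt0 (i : 'I_(\dim U)) : (k <= i)%N -> (ritz A U)`_i - t < 0.
  move=> ki; rewrite subr_lt0; apply: le_lt_trans rt.
  by apply: ritz_nonincreasing; rewrite ki ltn_ord.
(* The coordinate j of w is nonzero, hence k <= j and its term is negative. *)
rewrite wE (excess_diag _ _ Vonb.1 VD) (bigD1 j) //=.
have nn (i : 'I_(\dim U)) : ((ritz A U)`_i - t) * normc (c i 0) ^+ 2 <= 0.
  case: (ltnP i k) => [/c0->|/lt0/ltW ki]; first by rewrite normc0 expr0n mulr0.
  by rewrite mulr_le0_ge0 ?sqr_ge0.
rewrite -[X in _ < X]addr0 ltr_leD ?sumr_le0 //.
rewrite nmulr_rlt0; last by apply: lt0; rewrite leqNgt; apply: contra cj => /c0->.
rewrite lt_def sqr_ge0 andbT sqrf_eq0; apply: contra cj => /eqP/eq0_normc->.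
by rewrite eqxx.
Qed.

Lemma ritz_last_le (U : {vspace 'cV[C]_n}) u t : u \in U -> u != 0 ->
  excess A t u <= 0 -> (ritz A U)`_(\dim U).-1 <= t.
Proof.
move=> uU /sqnorm_gt0 u0; have := excess_ritz_ge0 uU.
rewrite (excess_shift _ t) => Hge Hle; rewrite leNgt; apply/negP => lt.
have : (t - (ritz A U)`_(\dim U).-1) * sqnorm u < 0.
  by rewrite pmulr_llt0 ?subr_lt0.
lra.
Qed.

End RitzBounds.
End MinMax.

(** * Ratios of distances to the two ends of an interval *)

Section Ratios.
Variable R : realFieldType.
Implicit Types L mu s t : R.

(** (L - t) / (t - mu) = (L - mu) / (t - mu) - 1 decreases in t > mu. *)
Lemma ratio_antitone L mu s t : mu <= L -> mu < s -> s <= t ->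
  (L - t) / (t - mu) <= (L - s) / (s - mu).
Proof.
move=> muL mus st; have mut := lt_le_trans mus st.
rewrite ler_pdivrMr ?subr_gt0 // mulrAC ler_pdivlMr ?subr_gt0 //.
have := mulr_ge0 (_ : 0 <= L - mu) (_ : 0 <= t - s); rewrite !subr_ge0.
by move=> /(_ muL st); nra.
Qed.

(** The arithmetic of one filter step: S and T are the squared norms of y and of
    the filtered vector y', e is the excess of y over the Ritz value s, and the
    excess of y' over t is zero.  The two inequalities compare excesses over L
    and over mu, whose quotient is the ratio in question. *)
Lemma ratio_contract L mu s t a b e S T : 0 < S -> 0 < T -> 0 <= a -> 0 < b ->
    mu < s -> s <= L -> 0 <= e ->
    a * (e + (s - L) * S) <= (t - L) * T ->
    b * (e + (s - mu) * S) <= (t - mu) * T ->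
  mu < t /\ (L - t) / (t - mu) <= a / b * ((L - s) / (s - mu)).
Proof.
move=> S0 T0 a0 b0 mus sL e0 num' den'.
have num : (L - t) * T <= a * ((L - s) * S).
  by have := mulr_ge0 a0 e0; lra.
have den : b * ((s - mu) * S) <= (t - mu) * T.
  by have := mulr_ge0 (ltW b0) e0; lra.
have d0 : 0 < b * ((s - mu) * S) by rewrite !mulr_gt0 ?subr_gt0.
have mut : mu < t by rewrite -subr_gt0 -(pmulr_lgt0 _ T0) (lt_le_trans d0).
split=> //; have N0 : 0 <= a * ((L - s) * S).
  by rewrite !mulr_ge0 ?subr_ge0 // ltW.
have -> : (L - t) / (t - mu) = (L - t) * T / ((t - mu) * T).
  by field; rewrite !lt0r_neq0 ?subr_gt0.
have -> : a / b * ((L - s) / (s - mu)) =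
    a * ((L - s) * S) / (b * ((s - mu) * S)).
  by field; rewrite !lt0r_neq0 ?subr_gt0.
have T0' : 0 < (t - mu) * T by rewrite mulr_gt0 ?subr_gt0.
apply: le_trans (_ : a * ((L - s) * S) / ((t - mu) * T) <= _).
  by rewrite ler_pM2r ?invr_gt0.
by rewrite ler_wpM2l // lef_pV2.
Qed.

End Ratios.

(** * Coordinates in the eigenbasis *)

Section Eigenbasis.
Variable R : rcfType.
Local Notation C := R[i].
Variables (n : nat) (A : 'M[C]_n) (lam : 'I_n -> R) (x : 'I_n -> 'cV[C]_n).
Hypothesis Ax : forall j, A *m x j = (lam j)%:C%C *: x j.
Hypothesis x_orthonormal : forall j k, dotcv (x j) (x k) = (j == k)%:R.

Definition weight (u : 'cV[C]_n) j : R := normc (dotcv u (x j)) ^+ 2.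

Lemma weight_ge0 u j : 0 <= weight u j.
Proof. exact: sqr_ge0. Qed.

Let X : 'M[C]_n := \matrix_(i, j) x j i 0.

Let colX j : col j X = x j.
Proof. by apply/colP => i; rewrite !mxE. Qed.

Let XX : X^t* *m X = 1%:M.
Proof.
apply/matrixP => j k; rewrite [RHS]mxE eq_sym -x_orthonormal dotcvE !mxE.
by apply: eq_bigr => i _; rewrite !mxE.
Qed.

Lemma excess_eigen t u : excess A t u = \sum_j (lam j - t) * weight u j.
Proof.
have XAX : X^t* *m A *m X = diag_mx (\row_j (lam j)%:C%C).
  have AX : A *m X = X *m diag_mx (\row_j (lam j)%:C%C).
    apply/matrixP => i j; rewrite mul_mx_diag !mxE.
    have /colP/(_ i) := Ax j; rewrite !mxE mulrC => <-.
    by apply: eq_bigr => k _; rewrite mxE.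
  by rewrite -mulmxA AX mulmxA XX mul1mx.
rewrite -[u in LHS]mul1mx -(mulmx1C XX) -mulmxA (excess_diag _ _ XX XAX).
by apply: eq_bigr => j _; rewrite coord_dotcv colX.
Qed.

Section SpectralFilter.
Variable f : R -> C.

Lemma dotcv_matfun u k :
  dotcv (matfun f lam x *m u) (x k) = f (lam k) * dotcv u (x k).
Proof.
have xx j : (x k)^t* *m x j = (k == j)%:R%:M.
  apply/matrixP => a b.
  by rewrite !ord1 -dotcvE x_orthonormal eq_sym [RHS]mxE eqxx.
rewrite !dotcvE mulmxA /matfun mulmx_sumr (bigD1 k) //= big1 => [|j jk].
  by rewrite addr0 -scalemxAr mulmxA xx eqxx mul1mx -scalemxAl mxE.
by rewrite -scalemxAr mulmxA xx eq_sym (negPf jk) raddf0 mul0mx scaler0.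
Qed.

Lemma weight_matfun u j :
  weight (matfun f lam x *m u) j = normc (f (lam j)) ^+ 2 * weight u j.
Proof. by rewrite /weight dotcv_matfun normcM exprMn. Qed.

(** Only the eigenvectors that occur in u matter.  The inequality required of
    them holds when |f|^2 is at least c at the eigenvalues above t and at most c
    at those below t, so a filter that favours the upper part of the spectrum
    raises the excess to at least c times its value. *)
Lemma excess_matfun_ge c t u :
    (forall j, dotcv u (x j) != 0 ->
       c * (lam j - t) <= normc (f (lam j)) ^+ 2 * (lam j - t)) ->
  c * excess A t u <= excess A t (matfun f lam x *m u).
Proof.
move=> cf; rewrite !excess_eigen mulr_sumr; apply: ler_sum => j _.
rewrite weight_matfun [X in _ <= X]mulrCA [X in X <= _]mulrA [X in _ <= X]mulrA.
have [uj0|/cf cfj] := eqVneq (dotcv u (x j)) 0; last first.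
  by rewrite ler_wpM2r ?weight_ge0.
by rewrite /weight uj0 normc0 expr0n !mulr0.
Qed.

End SpectralFilter.

Lemma excess_le0 t u : (forall j, dotcv u (x j) != 0 -> lam j <= t) ->
  excess A t u <= 0.
Proof.
move=> lt; rewrite excess_eigen; apply: sumr_le0 => j _.
have [uj0|/lt ltj] := eqVneq (dotcv u (x j)) 0; last first.
  by rewrite mulr_le0_ge0 ?weight_ge0 ?subr_le0.
by rewrite /weight uj0 normc0 expr0n !mulr0.
Qed.

(** * Effect of f(A) on the smallest Ritz value *)

Section FilteredRitz.
Hypothesis Ah : A \is hermsymmx.
Hypothesis lam_noninc : forall j k : 'I_n, (j <= k)%N -> lam k <= lam j.
Variables (f : R -> C) (i p : 'I_n) (fmax : R) (U : {vspace 'cV[C]_n}).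
Hypothesis ip : (i < p)%N.
Hypothesis U_gap :
  {in U, forall u (j : 'I_n), (i < j < p)%N -> dotcv u (x j) = 0}.
Hypothesis dimU : \dim U = i.+1.
Let U' := mximg (matfun f lam x) U.
Hypothesis dimU' : \dim U' = i.+1.

Let support u (j : 'I_n) :
  u \in U -> dotcv u (x j) != 0 -> (j <= i)%N || (p <= j)%N.
Proof.
move=> uU; apply: contra_neqT; rewrite negb_or -!ltnNge; exact: U_gap uU j.
Qed.

(** U has dimension i + 1, so it contains a nonzero vector orthogonal to the
    first i eigenvectors; its Rayleigh quotient is at most lam i. *)
Lemma ritz_last_le_eigenvalue : (ritz A U)`_i <= lam i.
Proof.
have [|u [uU uN0 u0]] := @exists_orthogonal _ _ _ x 0 i U.
  by rewrite subn0 dimU.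
have := ritz_last_le Ah uU uN0; rewrite dimU; apply.
apply: excess_le0 => j uj; apply: lam_noninc.
by rewrite leqNgt; apply: contra_neqN uj => /u0.
Qed.

(** The vector y' that attains the smallest Ritz value in U' is compared with
    its preimage y, which need not attain the smallest one in U: a lower bound
    on its Rayleigh quotient is enough. *)
Lemma ritz_filter_ratio :
    0 <= fmax -> fmax < normc (f (lam i)) ->
    (forall j : 'I_n, (j <= i)%N -> normc (f (lam i)) <= normc (f (lam j))) ->
    (forall j : 'I_n, (p <= j)%N -> normc (f (lam j)) <= fmax) ->
    lam p < (ritz A U)`_i ->
  lam p < (ritz A U')`_i /\
  (lam i - (ritz A U')`_i) / ((ritz A U')`_i - lam p) <=
    fmax ^+ 2 / normc (f (lam i)) ^+ 2 *
    ((lam i - (ritz A U)`_i) / ((ritz A U)`_i - lam p)).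
Proof.
move=> fmax0 f_gt f_head f_tail mu_eta.
have [] := excess_ritz_eq0 (U := U') Ah; first by rewrite dimU'.
rewrite dimU' => _ [/mximgP[y yU ->]].
set y' := matfun f lam x *m y; set eta' := (ritz A U')`_i => y'N0 y'_eta'.
have yN0 : y != 0 by apply: contra_neq y'N0; rewrite /y' => ->; rewrite mulmx0.
have := excess_ritz_ge0 Ah yU; rewrite dimU /=.
have := ritz_last_le_eigenvalue; set eta := (ritz A U)`_i in mu_eta *.
move=> eta_le y_eta.
have sq_le (a b : R) : 0 <= a -> a <= b -> a ^+ 2 <= b ^+ 2.
  by move=> a0 ab; rewrite ler_sqr ?nnegrE // (le_trans a0).
have fi0 : 0 < normc (f (lam i)) := le_lt_trans fmax0 f_gt.
have num : fmax ^+ 2 * excess A (lam i) y <= excess A (lam i) y'.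
  apply: excess_matfun_ge => j /(support yU) /orP[ji|pj].
    rewrite ler_wpM2r ?subr_ge0 ?lam_noninc //.
    by apply: sq_le => //; apply: le_trans (ltW f_gt) (f_head j ji).
  rewrite ler_wnM2r ?subr_le0 ?lam_noninc ?(ltnW (leq_trans ip pj)) //.
  exact: sq_le (normc_ge0 _) (f_tail j pj).
have den : normc (f (lam i)) ^+ 2 * excess A (lam p) y <= excess A (lam p) y'.
  apply: excess_matfun_ge => j /(support yU) /orP[ji|pj].
    rewrite ler_wpM2r ?subr_ge0 ?lam_noninc ?(leq_trans ji (ltnW ip)) //.
    exact: sq_le (ltW fi0) (f_head j ji).
  rewrite ler_wnM2r ?subr_le0 ?lam_noninc //.
  by apply: sq_le (normc_ge0 _) _; apply: le_trans (f_tail j pj) (ltW f_gt).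
have fmax2 := sqr_ge0 fmax; have fi2 := exprn_gt0 2 fi0.
move: num den; rewrite (excess_shift A eta (lam i)) (excess_shift A eta' (lam i)).
rewrite (excess_shift A eta (lam p)) (excess_shift A eta' (lam p)).
rewrite y'_eta' !add0r => num den.
exact: ratio_contract (sqnorm_gt0 yN0) (sqnorm_gt0 y'N0) fmax2 fi2 mu_eta
  eta_le y_eta num den.
Qed.

End FilteredRitz.
End Eigenbasis.

(** * Contraction of the Ritz value ratios under f(A) *)

Theorem theorem3p2 (R : realType) (n : nat) (A : 'M[R[i]]_n)
    (lam : 'I_n -> R) (x : 'I_n -> 'cV[R[i]]_n)
    (p : 'I_n) (Y : {vspace 'cV[R[i]]_n}) (f : R -> R[i]) :
  A \is hermsymmx ->
  (forall j k : 'I_n, (j <= k)%N -> lam k <= lam j) ->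
  (forall j : 'I_n, A *m x j = (lam j)%:C%C *: x j) ->
  (forall j k : 'I_n, dotcv (x j) (x k) = (j == k)%:R) ->
  (0 < p)%N -> \dim Y = p ->
  let fA := matfun f lam x in
  let Y' := mximg fA Y in
  let X_ (i : 'I_n) :=
    orthov (@dotcv R[i] n) <<[seq x j | j : 'I_n <- enum 'I_n & (i < j < p)%N]>>%VS in
  let Y_ (i : 'I_n) := (X_ i :&: Y)%VS in
  let Y'_ (i : 'I_n) := mximg fA (Y_ i) in
  let fmax := \big[Num.max/0]_(j < n | (p <= j)%N) normc (f (lam j)) in
  let eta_p := (ritz A Y)`_p.-1 in
  lam p < eta_p ->
  (forall j k : 'I_n, (j <= k < p)%N ->
     normc (f (lam k)) <= normc (f (lam j))) ->
  (forall j : 'I_n, j.+1 = p -> fmax < normc (f (lam j))) ->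
  \dim Y' = p /\
  forall i : 'I_n, (i < p)%N ->
    let eta := (ritz A (Y_ i))`_i in
    let eta' := (ritz A (Y'_ i))`_i in
    let eta'_Y' := (ritz A Y')`_i in
    [/\ \dim (Y_ i) = i.+1 /\ \dim (Y'_ i) = i.+1,
        [/\ eta - lam p != 0, eta' - lam p != 0 & eta'_Y' - lam p != 0],
        (lam i - eta') / (eta' - lam p) <=
          fmax ^+ 2 / normc (f (lam i)) ^+ 2 *
          ((lam i - eta) / (eta - lam p)) &
        (lam i - eta'_Y') / (eta'_Y' - lam p) <=
          fmax ^+ 2 / normc (f (lam i)) ^+ 2 *
          ((lam i - eta_p) / (eta_p - lam p))].
Proof.
move=> Ah lam_noninc Ax x_on p_gt0 dimY fA Y' X_ Y_ Y'_ fmax eta_p eta_gt.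
move=> f_noninc f_gap.
have fmax_ge0 : 0 <= fmax.
  by rewrite /fmax; elim/big_rec: _ => // j a _ a0; rewrite le_max a0 orbT.
have fmaxP (j : 'I_n) : (p <= j)%N -> normc (f (lam j)) <= fmax.
  by move=> pj; rewrite /fmax (bigD1 j) //= le_max lexx.
have f_gt (j : 'I_n) : (j < p)%N -> fmax < normc (f (lam j)).
  move=> jp; have pP : (p.-1 < n)%N by rewrite (leq_ltn_trans (leq_pred _)).
  apply: lt_le_trans (f_gap (Ordinal pP) _) (f_noninc _ _ _).
    by rewrite /= prednK.
  by rewrite /= -ltnS prednK // jp leqnn.
have Y_head_eq0 u : u \in Y ->
    (forall j : 'I_n, (j < p)%N -> dotcv u (x j) = 0) -> u = 0.
  move=> uY u0; apply: contraTeq eta_gt => uN0; rewrite -leNgt /eta_p -dimY.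
  apply: ritz_last_le uY uN0 _ => //; apply: (excess_le0 Ax x_on) => j uj.
  by apply: lam_noninc; rewrite leqNgt; apply: contra_neqN uj => /u0.
have fA_inj u : u \in Y -> fA *m u = 0 -> u = 0.
  move=> uY fu0; apply: Y_head_eq0 (uY) _ => j /f_gt fj.
  have /eqP := dotcv_matfun lam x_on f u j; rewrite -/fA fu0 linear0l eq_sym.
  rewrite mulf_eq0 => /orP[/eqP fj0|/eqP //].
  by move: fj; rewrite fj0 normc0 ltNge fmax_ge0.
have dim_fA (U : {vspace 'cV[R[i]]_n}) : (U <= Y)%VS ->
    \dim (mximg fA U) = \dim U.
  move=> UY; apply: limg_dim_eq; apply/eqP; rewrite -subv0.
  apply/subvP => u; rewrite memv_cap memv_ker lfunE memv0.
  by move=> /andP[/(subvP UY) uY /eqP fu]; apply/eqP/fA_inj.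
split; first by rewrite dim_fA ?subvv.
move=> i ip eta eta' eta'_Y'.
have YiY : (Y_ i <= Y)%VS by exact: capvSr.
have YiP u : u \in Y_ i -> forall j : 'I_n, (i < j < p)%N -> dotcv u (x j) = 0.
  by rewrite memv_cap => /andP[/orthocomplP].
have dimYi : \dim (Y_ i) = i.+1.
  apply/eqP; rewrite eqn_leq; apply/andP; split; last first.
    rewrite -(leq_add2r (p - i.+1)) subnKC // -[X in (X <= _)%N]dimY.
    exact: dim_orthocompl.
  (* A larger dimension would leave room for a nonzero vector of Y orthogonal
     to the first i + 1 eigenvectors as well, hence to the first p. *)
  rewrite leqNgt; apply/negP => iY.
  have [|u [uYi uN0 u0]] := @exists_orthogonal _ _ _ x 0 i.+1 (Y_ i).
    by rewrite subn0.
  have := uN0; rewrite (Y_head_eq0 u) ?eqxx ?(subvP YiY) // => j jp.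
  case: (ltnP j i.+1) => [ji|ij]; first by rewrite u0.
  by rewrite (YiP u) // ij jp.
have dimY'i : \dim (Y'_ i) = i.+1 by rewrite dim_fA.
have eta_ge : eta_p <= eta.
  apply: (ritz_ge Ah (subvv _)) => [|u uYi]; first by rewrite dimYi.
  by rewrite /eta_p -dimY excess_ritz_ge0 // (subvP YiY).
have mu_eta := lt_le_trans eta_gt eta_ge.
have mu_le : lam p <= lam i by apply: lam_noninc; exact: ltnW.
have f_head (j : 'I_n) : (j <= i)%N -> normc (f (lam i)) <= normc (f (lam j)).
  by move=> ji; rewrite f_noninc // ji ip.
have [mu_eta' ratio_i] := ritz_filter_ratio Ax x_on Ah lam_noninc ip YiP dimYi
  dimY'i fmax_ge0 (f_gt i ip) f_head fmaxP mu_eta.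
have eta'_le : eta' <= eta'_Y'.
  apply: (ritz_ge Ah (limgS _ YiY)) => [|u uY'i]; first by rewrite dimY'i.
  by have := excess_ritz_ge0 Ah uY'i; rewrite dimY'i.
split=> //.
  by split; rewrite subr_eq0 gt_eqF // (lt_le_trans mu_eta').
apply: le_trans (ratio_antitone mu_le mu_eta' eta'_le) _.
apply: le_trans ratio_i _; rewrite ler_wpM2l ?divr_ge0 ?sqr_ge0 //.
exact: ratio_antitone.
Qed.
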